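(* Let $d\ge1$ and $n\ge2$. For $k\ge1$, let $$\mathcal{R}(\mathcal{M}_k):=\inf_{\tilde f}\sup_{f\in\mathcal{M}_k}\mathbb{E}_f\,\mathfrak{H}^2(\tilde f,f),$$ where $\mathbb{E}_f$ denotes expectation when the data $X_1,\dots,X_n$ are independent observations drawn from the density $f$, and the infimum is over all estimators $\tilde f$ based on $X_1,\dots,X_n$. Then there exists a universal positive constant $C$ such that $$\mathcal{R}(\mathcal{M}_k)\ge C\,\frac kn\qquad\text{for every }1\le k\le n.$$
   Context: $\phi_d(z):=(2\pi)^{-d/2}\exp(-\|z\|^2/2)$ is the standard normal density on $\mathbb{R}^d$; for a probability measure $G$ on $\mathbb{R}^d$, $f_G(x):=\int\phi_d(x-\theta)\,dG(\theta)$. $\mathcal{M}_k$ is the collection of all densities $f_G$ where $G$ is a discrete probability measure on $\mathbb{R}^d$ with at most $k$ atoms. $\mathfrak{H}^2(f,g):=\int(\sqrt{f(x)}-\sqrt{g(x)})^2dx$ is the squared Hellinger distance. *)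

(* Defs.v *)
From HB Require Import structures.
From mathcomp Require Import all_boot all_order all_algebra.
From mathcomp Require Import all_classical all_reals all_analysis.

Set Implicit Arguments.
Unset Strict Implicit.
Unset Printing Implicit Defensive.

Import Order.TTheory GRing.Theory Num.Theory.
Import numFieldNormedType.Exports.

Local Open Scope classical_set_scope.
Local Open Scope ring_scope.

Section tuple_measure.
Local Open Scope ereal_scope.
Context d (T : measurableType d) (R : realType).

Definition tuple_cons n (p : T * n.-tuple T) : n.+1.-tuple T :=
  [tuple of p.1 :: p.2].

Definition tuple_measureS n (mu : set T -> \bar R)
    (nu : set (n.-tuple T) -> \bar R) : set (n.+1.-tuple T) -> \bar R :=
  pushforward (mu \x nu) (@tuple_cons n).

(* The n-fold product of mu, on the product sigma-algebra of n.-tuple T.  As for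
   the library's \x, mu is a bare set function, so that the definition also
   applies to a law given by a density; it is meant for sigma-finite measures,
   for which the instances and tuple_measure_box below hold. *)
Fixpoint tuple_measure (mu : set T -> \bar R) n : set (n.-tuple T) -> \bar R :=
  match n return set (n.-tuple T) -> \bar R with
  | 0 => \d_([tuple] : 0.-tuple T)
  | m.+1 => tuple_measureS mu (@tuple_measure mu m)
  end.

Lemma measurable_tuple_cons n :
  measurable_fun [set: T * n.-tuple T] (@tuple_cons n).
Proof. exact: (@measurable_cons _ _ _ _ fst n snd). Qed.

Lemma measurable_tuple_box n (A : 'I_n -> set T) :
  (forall i, measurable (A i)) ->
  measurable [set x : n.-tuple T | forall i, A i (tnth x i)].
Proof.
move=> mA.
rewrite (_ : [set x | _] =
  \bigcap_(i in [set: 'I_n]) (@tnth n T)^~ i @^-1` A i).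
  apply: fin_bigcap_measurable; first exact: finite_finset.
  by move=> i _; rewrite -[X in measurable X]setTI; exact: measurable_tnth.
by apply/seteqP; split => x /= h i; [move=> _|]; exact: h.
Qed.

Lemma preimage_tuple_cons_box n (A : 'I_n.+1 -> set T) :
  @tuple_cons n @^-1` [set x | forall i, A i (tnth x i)] =
  A ord0 `*` [set x | forall i, A (lift ord0 i) (tnth x i)].
Proof.
apply/seteqP; split => -[a x] /= => [h|[h0 h] i].
  split=> [|i]; first by have := h ord0.
  by have := h (lift ord0 i); rewrite tnthS.
by case: (unliftP ord0 i) => [j|] ->//; rewrite tnthS.
Qed.

End tuple_measure.
Arguments tuple_measure {d T R} mu n _.

Section tuple_measureS.
Local Open Scope ereal_scope.
Context d (T : measurableType d) (R : realType) (n : nat).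
Variables (mu : {sigma_finite_measure set T -> \bar R})
  (nu : {sigma_finite_measure set (n.-tuple T) -> \bar R}).

Let mcons := @measurable_tuple_cons d T n.

Let mpre (A : set (n.+1.-tuple T)) :
  measurable A -> measurable (@tuple_cons _ T n @^-1` A).
Proof. by move=> mA; rewrite -[X in measurable X]setTI; exact: mcons. Qed.

Let S0 : tuple_measureS mu nu set0 = 0.
Proof. exact: (@measure0 _ _ _ (mu \x nu)). Qed.

Let S_ge0 A : 0 <= tuple_measureS mu nu A.
Proof. exact: (@measure_ge0 _ _ _ (mu \x nu)). Qed.

Let S_sigma_additive : semi_sigma_additive (tuple_measureS mu nu).
Proof.
move=> F mF tF mUF; rewrite /tuple_measureS /pushforward preimage_bigcup.
apply: measure_semi_sigma_additive => [i||].
- exact: mpre.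
- apply/trivIsetP => i j _ _ ij; rewrite -preimage_setI.
  by move/trivIsetP : tF => ->//; rewrite preimage_set0.
- by rewrite -preimage_bigcup; exact: mpre.
Qed.

HB.instance Definition _ :=
  isMeasure.Build _ _ _ (tuple_measureS mu nu) S0 S_ge0 S_sigma_additive.

Let S_sigma_finite : sigma_finite setT (tuple_measureS mu nu).
Proof.
have /sigma_finiteP[F [TF ndF Foo]] := sigma_finiteT mu.
have /sigma_finiteP[G [TG ndG Goo]] := sigma_finiteT nu.
pose uncons (x : n.+1.-tuple T) := (thead x, [tuple of behead x] : n.-tuple T).
have muncons : measurable_fun setT uncons.
  apply: measurable_fun_pair; first exact: measurable_tnth.
  exact: measurable_behead.
have consK : cancel (@tuple_cons d T n) uncons.
  by move=> [a x]; congr (_, _); exact: val_inj.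
exists (fun i => uncons @^-1` (F i `*` G i)).
  apply/seteqP; split => // x _.
  have [i _ Fi] : (\bigcup_i F i) (uncons x).1 by rewrite -TF.
  have [j _ Gj] : (\bigcup_i G i) (uncons x).2 by rewrite -TG.
  exists (maxn i j) => //; split.
    by move: Fi; apply/subsetPset/ndF; rewrite leq_maxl.
  by move: Gj; apply/subsetPset/ndG; rewrite leq_maxr.
move=> i; have [mF Fi] := Foo i; have [mG Gi] := Goo i; split.
  by rewrite -[X in measurable X]setTI; apply: muncons => //; exact: measurableX.
rewrite /tuple_measureS /pushforward -comp_preimage.
rewrite (_ : uncons \o _ = id); last by apply/funext => p; exact: consK.
by rewrite preimage_id product_measure1E// lte_mul_pinfty// ge0_fin_numE.
Qed.

HB.instance Definition _ := @Measure_isSigmaFinite.Build _ _ _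
  (tuple_measureS mu nu) S_sigma_finite.

End tuple_measureS.

Section tuple_measure_sigma_finite.
Local Open Scope ereal_scope.
Context d (T : measurableType d) (R : realType).
Variables (mu : {sigma_finite_measure set T -> \bar R}) (n : nat).

Let tuple_measureP :
  exists nu : {sigma_finite_measure set (n.-tuple T) -> \bar R},
    nu = tuple_measure mu n :> (set (n.-tuple T) -> \bar R).
Proof.
elim: n => [|m [nu nuE]] /=; first by exists \d_([tuple] : 0.-tuple T).
by rewrite -nuE; exists (tuple_measureS mu nu).
Qed.

Let tm0 : tuple_measure mu n set0 = 0.
Proof. by have [nu <-] := tuple_measureP; rewrite measure0. Qed.

Let tm_ge0 A : 0 <= tuple_measure mu n A.
Proof. by have [nu <-] := tuple_measureP. Qed.

Let tm_sigma_additive : semi_sigma_additive (tuple_measure mu n).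
Proof.
by have [nu <-] := tuple_measureP; exact: measure_semi_sigma_additive.
Qed.

HB.instance Definition _ :=
  isMeasure.Build _ _ _ (tuple_measure mu n) tm0 tm_ge0 tm_sigma_additive.

Let tm_sigma_finite : sigma_finite setT (tuple_measure mu n).
Proof. by have [nu <-] := tuple_measureP; exact: sigma_finiteT. Qed.

HB.instance Definition _ := @Measure_isSigmaFinite.Build _ _ _
  (tuple_measure mu n) tm_sigma_finite.

End tuple_measure_sigma_finite.

Lemma tuple_measure_box d (T : measurableType d) (R : realType)
    (mu : {sigma_finite_measure set T -> \bar R}) n (A : 'I_n -> set T) :
  (forall i, measurable (A i)) ->
  tuple_measure mu n [set x | forall i, A i (tnth x i)]
  = (\prod_(i < n) mu (A i))%E.
Proof.
elim: n A => [|n IH] A mA.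
  by rewrite big_ord0 /= diracE mem_set//= => -[].
rewrite big_ord_recl -IH//= /tuple_measureS /pushforward.
rewrite preimage_tuple_cons_box product_measure1E//.
by apply: (@measurable_tuple_box _ _ n (A \o lift ord0)) => i; exact: mA.
Qed.

Section gaussian_mixtures.
Context (R : realType) (d : nat).
Local Notation E := (d.-tuple (measurableTypeR R)).
Implicit Types (f g : E -> R) (G : probability E R).

Definition lebesgue_measure_tuple : set E -> \bar R :=
  tuple_measure lebesgue_measure d.

HB.instance Definition _ := SigmaFiniteMeasure.on lebesgue_measure_tuple.

Definition euclidean_norm (z : E) : R := Num.sqrt (\sum_(i < d) tnth z i ^+ 2).

Definition tuple_sub (x y : E) : E := [tuple tnth x i - tnth y i | i < d].

Definition std_normal_density (z : E) : R :=
  (2 * pi) `^ (- (d%:R / 2)) * expR (- (euclidean_norm z ^+ 2 / 2)).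

Definition gaussian_mixture G : E -> R := fun x =>
  \int[G]_theta std_normal_density (tuple_sub x theta).

Definition atoms G : set E := [set t | (0 < G [set t])%E].

Definition gaussian_mixtures (k : nat) : set (E -> R) :=
  [set f | exists G : probability E R,
    [/\ G (atoms G) = 1%E, (atoms G #<= `I_k)%card & f = gaussian_mixture G]].

Definition sq_hellinger f g : \bar R :=
  (\int[lebesgue_measure_tuple]_x ((Num.sqrt (f x) - Num.sqrt (g x)) ^+ 2)%:E)%E.

Definition density_law f : set E -> \bar R :=
  fun A => (\int[lebesgue_measure_tuple]_(x in A) (f x)%:E)%E.

(* Estimators are nonnegative, so that the square root in the loss is genuine,
   and jointly measurable in the sample and the point; they are not required
   to integrate to one. *)
Definition estimators (n : nat) : set (n.-tuple E -> E -> R) :=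
  [set h : n.-tuple E -> E -> R |
    measurable_fun [set: n.-tuple E * E] (fun p => h p.1 p.2) /\
    forall X x, 0 <= h X x].

Definition hellinger_risk n (h : n.-tuple E -> E -> R) f : \bar R :=
  (\int[tuple_measure (density_law f) n]_X sq_hellinger (h X) f)%E.

Definition minimax_risk (n : nat) (M : set (E -> R)) : \bar R :=
  ereal_inf [set ereal_sup [set hellinger_risk h f | f in M] |
    h in @estimators n].

End gaussian_mixtures.
Arguments gaussian_mixtures R d k _ : clear implicits.

(* Main.v *)
From HB Require Import structures.
Require Import Defs.
From mathcomp Require Import all_boot all_order all_algebra.
From mathcomp Require Import all_classical all_reals all_analysis.
From mathcomp Require Import measurable_realfun ring lra.

Import Order.TTheory GRing.Theory Num.Theory.
Local Open Scope classical_set_scope.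
Local Open Scope ring_scope.

(** The bound is proved by Assouad's method, with k-atomic mixtures indexed by
    the vertices of a cube of dimension k.

    Put k atoms of weight 1 / k at very distant places on the first axis, and
    for each vertex of the cube displace the j-th atom by eta along that axis
    when the j-th coordinate of the vertex is true, where eta^2 = k / n <= 1.
    Moving one atom changes the density by a squared Hellinger distance of order
    eta^2 / k = 1 / n, in two senses. It is at most that much, so the affinity
    of two neighbouring vertices is at least 1 - 1 / (8 n)
    ([line_mixture_affinity]) and the affinity of the laws of n observations
    is at least 7 / 8: no test separates neighbours reliably. And at least that much is
    visible in a slab next to the moved atom ([line_mixture_separation]), where
    the distant atoms contribute almost nothing.

    The slabs are disjoint, so the loss of an estimator is at least the sum of
    its losses on the k slabs. For each slab, pairing the vertices that differ
    only in the matching atom, Le Cam's two-point bound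
    ([two_point_lower_bound]) shows that the two partial risks sum to at least
    a constant over n. Averaging over all vertices ([assouad]) gives a risk of
    order at least k / n for some vertex.

    All atoms lie on one axis, so the mixtures are products of a mixture on the
    line and the standard normal density in the other coordinates, and affinity
    and separation do not depend on the dimension ([integral_head_tail]). This
    is why the constant is universal. *)

Set Implicit Arguments.
Unset Strict Implicit.
Unset Printing Implicit Defensive.

(** * Laws given by a density, and iterated integrals on tuples *)

Section density.
Context d (T : measurableType d) (R : realType).
Variable mu : {sigma_finite_measure set T -> \bar R}.
Implicit Types f : T -> R.

Definition density_measure f : set T -> \bar R :=
  fun A => (\int[mu]_(x in A) (f x)%:E)%E.

Definition probability_density f : Prop :=
  [/\ measurable_fun setT f, forall x, 0 <= f x &
      (\int[mu]_x (f x)%:E = 1)%E].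

Section density_probability.
Variable f : T -> R.
Hypothesis df : probability_density f.

Let m0 : density_measure f set0 = 0%E.
Proof. by rewrite /density_measure integral_set0. Qed.

Let m_ge0 A : (0 <= density_measure f A)%E.
Proof. by case: df => _ f0 _; apply: integral_ge0 => x _; rewrite lee_fin. Qed.

Let m_sigma_additive : semi_sigma_additive (density_measure f).
Proof.
case: df => mf f0 _.
apply: (@semi_sigma_additive_nng_induced _ _ _ mu (EFin \o f)) => [|x].
  exact/measurable_EFinP.
by rewrite /= lee_fin.
Qed.

Let m_setT : density_measure f setT = 1%E. Proof. by case: df. Qed.

(** The proof argument lets the canonical probability structure be found from
    the term alone, so that sample laws can be written [tuple_measure] of it. *)
Definition density_probability (_ : probability_density f) :=
  density_measure f.

HB.instance Definition _ := isMeasure.Build _ _ _ (density_probability df)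
  m0 m_ge0 m_sigma_additive.

HB.instance Definition _ :=
  Measure_isProbability.Build _ _ _ (density_probability df) m_setT.

End density_probability.

(** The density is almost everywhere the Radon-Nikodym derivative of its law,
    since both have the same integral on every measurable set; the change of
    variables for that derivative does the rest. *)
Lemma integral_density f (df : probability_density f) (g : T -> \bar R) :
  measurable_fun setT g -> (forall x, (0 <= g x)%E) ->
  (\int[density_probability df]_x g x = \int[mu]_x ((f x)%:E * g x))%E.
Proof.
move=> mg g0; have [mf f0 f1] := df.
have mEf : measurable_fun setT (EFin \o f) by exact/measurable_EFinP.
have dom : density_probability df `<< mu.
  apply/null_content_dominatesP => A mA muA0.
  by apply: null_set_integral => //; exact: measurable_funTS.
rewrite -(Radon_Nikodym_SigmaFinite.change_of_variables dom g0 measurableT mg).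
have iRN := Radon_Nikodym_SigmaFinite.f_integrable dom.
have mRN := measurable_int _ iRN.
apply: ae_eq_integral => //.
- exact: emeasurable_funM.
- exact: emeasurable_funM.
under [X in ae_eq _ _ _ X]eq_fun do rewrite muleC.
apply: ae_eqe_mul2l.
apply: integral_ae_eq => // A _ mA.
by rewrite -Radon_Nikodym_SigmaFinite.f_integral.
Qed.

End density.

Lemma integral_tuple_measureS d (T : measurableType d) (R : realType)
    (mu : {sigma_finite_measure set T -> \bar R}) n
    (F : n.+1.-tuple T -> \bar R) :
  measurable_fun setT F -> (forall X, (0 <= F X)%E) ->
  (\int[tuple_measure mu n.+1]_X F X =
   \int[mu]_x \int[tuple_measure mu n]_X F (tuple_cons (x, X)))%E.
Proof.
move=> mF F0 /=; rewrite /tuple_measureS.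
rewrite (ge0_integral_pushforward (@measurable_tuple_cons d T n)
  (mu \x tuple_measure mu n)%E measurableT mF)//.
rewrite preimage_setT fubini_tonelli1//; last by move=> p; exact: F0.
by apply: measurableT_comp => //; exact: measurable_tuple_cons.
Qed.

Lemma measurable_integral_tuple_cons d (T : measurableType d) (R : realType)
    (mu : {sigma_finite_measure set T -> \bar R}) n
    (F : n.+1.-tuple T -> \bar R) :
  measurable_fun setT F -> (forall X, (0 <= F X)%E) ->
  measurable_fun setT
    (fun x => \int[tuple_measure mu n]_X F (tuple_cons (x, X)))%E.
Proof.
move=> mF F0.
apply: (measurable_fun_fubini_tonelli_F
  (m2 := tuple_measure mu n) (F \o @tuple_cons d T n)); last by move=> p; exact: F0.
by apply: measurableT_comp => //; exact: measurable_tuple_cons.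
Qed.

(** * Testing two densities from n observations *)

(** With m the smaller and M the larger number this is
    sqrt (m M) <= m + M / 4, the inequality of arithmetic and geometric
    means. *)
Lemma sqrtrM_le_minr_add (R : realType) (a b : R) : 0 <= a -> 0 <= b ->
  Num.sqrt (a * b) <= Num.min a b + (a + b) / 4.
Proof.
wlog ab : a b / a <= b => [H a0 b0|a0 b0].
  have [ab|ab] := orP (le_total a b); first exact: H.
  by rewrite mulrC minC (addrC a); exact: H.
rewrite (min_idPl ab) sqrtrM//.
have := sqr_sqrtr a0; have := sqr_sqrtr b0.
by have := sqr_ge0 (Num.sqrt a - Num.sqrt b / 2); nra.
Qed.

Lemma measurable_sqrtr (R : realType) : measurable_fun [set: R] (@Num.sqrt R).
Proof. exact: (continuous_measurable_fun (@sqrt_continuous R)). Qed.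

Section two_points.
Context d (T : measurableType d) (R : realType).
Variable mu : {sigma_finite_measure set T -> \bar R}.
Variables p q : T -> R.
Hypotheses (dp : probability_density mu p) (dq : probability_density mu q).

(** Le Cam's two-point bound. If two losses sum to at least [D] at every sample,
    they cannot both have small expectation under laws of large affinity: at a
    sample with weights a and b, the weighted loss is at least min(a, b) D,
    hence at least (sqrt (a b) - (a + b) / 4) D, and the affinity of a
    product law is a product. Keeping the weights [a] and [b] free is what makes
    the induction on the sample size close: integrating out one observation
    [x] turns them into [a * p x] and [b * q x], and the product densities
    never have to be written down. The negative term is moved to the right so
    that both sides are integrals of nonnegative functions. *)
Lemma two_point_lower_bound n (L1 L2 : n.-tuple T -> \bar R) (D rho : R) :
  0 <= D -> 0 <= rho ->
  (rho%:E <= \int[mu]_x (Num.sqrt (p x * q x))%:E)%E ->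
  measurable_fun setT L1 -> measurable_fun setT L2 ->
  (forall X, (0 <= L1 X)%E) -> (forall X, (0 <= L2 X)%E) ->
  (forall X, (D%:E <= L1 X + L2 X)%E) ->
  forall a b : R, 0 <= a -> 0 <= b ->
  ((D * (Num.sqrt (a * b) * rho ^+ n))%:E <=
   a%:E * \int[tuple_measure (density_probability dp) n]_X L1 X +
   b%:E * \int[tuple_measure (density_probability dq) n]_X L2 X +
   (D * ((a + b) / 4))%:E)%E.
Proof.
move=> D0 rho0 rhole.
have [mp p0 p1] := dp; have [mq q0 q1] := dq.
elim: n L1 L2 => [|n IH] L1 L2 mL1 mL2 L10 L20 L12 a b a0 b0.
  rewrite expr0 mulr1 /= !integral_dirac// !diracT !mul1e.
  have m0 : 0 <= Num.min a b by rewrite le_min a0.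
  have := sqrtrM_le_minr_add a0 b0.
  set m := Num.min a b in m0 * => sab.
  apply: (@le_trans _ _ (m%:E * (L1 [tuple] + L2 [tuple]) +
    (D * ((a + b) / 4))%:E)%E).
    apply: (@le_trans _ _ (m%:E * D%:E + (D * ((a + b) / 4))%:E)%E).
      by rewrite -EFinM -EFinD lee_fin mulrC; nra.
    by rewrite leeD2r// lee_wpmul2l.
  rewrite leeD2r// ge0_muleDr//; apply: leeD; apply: lee_wpmul2r => //.
    by rewrite lee_fin ge_min lexx.
  by rewrite lee_fin ge_min lexx orbT.
rewrite !integral_tuple_measureS//.
have mI1 := measurable_integral_tuple_cons (density_probability dp) mL1 L10.
have mI2 := measurable_integral_tuple_cons (density_probability dq) mL2 L20.
set I1 := fun x => _ in mI1; set I2 := fun x => _ in mI2.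
have I10 x : (0 <= I1 x)%E by exact: integral_ge0.
have I20 x : (0 <= I2 x)%E by exact: integral_ge0.
rewrite !integral_density//.
(* The right-hand side becomes one integral in the first observation, with
   integrand [A x + B x + C x]; the left-hand side is a multiple of the
   affinity. The induction hypothesis at [x] compares the integrands. *)
have mEp : measurable_fun setT (EFin \o p) by exact/measurable_EFinP.
have mEq : measurable_fun setT (EFin \o q) by exact/measurable_EFinP.
have mEs : measurable_fun setT (fun x => (Num.sqrt (p x * q x))%:E).
  apply/measurable_EFinP.
  apply: (measurableT_comp (@measurable_sqrtr R)).
  exact: measurable_funM.
pose c := D * Num.sqrt (a * b) * rho ^+ n.
have c0 : 0 <= c by rewrite !mulr_ge0// ?exprn_ge0.
pose A x := (a%:E * ((p x)%:E * I1 x))%E.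
pose B x := (b%:E * ((q x)%:E * I2 x))%E.
pose C x := ((D * a / 4)%:E * (p x)%:E + (D * b / 4)%:E * (q x)%:E)%E.
have Da0 : 0 <= D * a / 4 by rewrite divr_ge0// mulr_ge0.
have Db0 : 0 <= D * b / 4 by rewrite divr_ge0// mulr_ge0.
have A0 x : (0 <= A x)%E by rewrite !mule_ge0// lee_fin.
have B0 x : (0 <= B x)%E by rewrite !mule_ge0// lee_fin.
have C0 x : (0 <= C x)%E by rewrite adde_ge0// mule_ge0// lee_fin.
have mA : measurable_fun setT A by apply: measurable_funeM; exact: emeasurable_funM.
have mB : measurable_fun setT B by apply: measurable_funeM; exact: emeasurable_funM.
have mC : measurable_fun setT C by apply: emeasurable_funD; exact: measurable_funeM.
have -> : (D * ((a + b) / 4))%:E = (\int[mu]_x C x)%E.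
  rewrite ge0_integralD//; last 4 first.
  - by move=> x _; rewrite mule_ge0// lee_fin.
  - exact: measurable_funeM.
  - by move=> x _; rewrite mule_ge0// lee_fin.
  - exact: measurable_funeM.
  rewrite !ge0_integralZl_EFin// ?p1 ?q1 ?mule1 -?EFinD.
  - by congr EFin; lra.
  - by move=> x _; rewrite lee_fin.
  - by move=> x _; rewrite lee_fin.
have -> : (a%:E * \int[mu]_x ((p x)%:E * I1 x) = \int[mu]_x A x)%E.
  rewrite -ge0_integralZl_EFin//; last exact: emeasurable_funM.
  by move=> x _; rewrite mule_ge0// lee_fin.
have -> : (b%:E * \int[mu]_x ((q x)%:E * I2 x) = \int[mu]_x B x)%E.
  rewrite -ge0_integralZl_EFin//; last exact: emeasurable_funM.
  by move=> x _; rewrite mule_ge0// lee_fin.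
have mAB : measurable_fun setT (fun x => A x + B x)%E by exact: emeasurable_funD.
have AB0 x : (0 <= A x + B x)%E by exact: adde_ge0.
rewrite -!ge0_integralD//.
apply: (@le_trans _ _ (\int[mu]_x (c%:E * (Num.sqrt (p x * q x))%:E))%E).
  rewrite ge0_integralZl_EFin//.
  rewrite (_ : D * _ = c * rho); last by rewrite /c exprSr; ring.
  by rewrite EFinM lee_wpmul2l.
apply: ge0_le_integral => //.
- by move=> x _; rewrite mule_ge0// lee_fin.
- exact: measurable_funeM.
- exact: emeasurable_funD.
move=> x _; have ap0 := mulr_ge0 a0 (p0 x); have bq0 := mulr_ge0 b0 (q0 x).
have mL1x : measurable_fun setT (fun X => L1 (tuple_cons (x, X))).
  apply: (measurableT_comp mL1).
  exact: (measurableT_comp (@measurable_tuple_cons _ T n)).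
have mL2x : measurable_fun setT (fun X => L2 (tuple_cons (x, X))).
  apply: (measurableT_comp mL2).
  exact: (measurableT_comp (@measurable_tuple_cons _ T n)).
have := IH _ _ mL1x mL2x (fun X => L10 _) (fun X => L20 _) (fun X => L12 _)
  _ _ ap0 bq0.
rewrite -/(I1 x) -/(I2 x) /A /B /C !muleA -!EFinM -EFinD.
rewrite mulrACA sqrtrM ?mulr_ge0// /c.
rewrite (_ : D * ((a * p x + b * q x) / 4) = D * a / 4 * p x + D * b / 4 * q x);
  last by lra.
rewrite (_ : D * (Num.sqrt (a * b) * Num.sqrt (p x * q x) * rho ^+ n) =
  D * Num.sqrt (a * b) * rho ^+ n * Num.sqrt (p x * q x)) //; ring.
Qed.
End two_points.

(** * Assouad's lemma *)

Section assouad.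
Context d (T : measurableType d) (R : realType).
Variable mu : {sigma_finite_measure set T -> \bar R}.
Variables k n : nat.
Local Notation cube := {ffun 'I_k -> bool}.

Definition flip (a : cube) (j : 'I_k) : cube :=
  [ffun i => if i == j then ~~ a i else a i].

Lemma flipK j : involutive (flip^~ j).
Proof.
by move=> a; apply/ffunP => i; rewrite !ffunE; case: eqP => // _; rewrite negbK.
Qed.

Variables (f : cube -> T -> R) (B : 'I_k -> set T).
Hypotheses (df : forall a, probability_density mu (f a))
  (mB : forall j, measurable (B j))
  (dB : forall i j x, B i x -> B j x -> i = j).

Lemma sum_indic_le1 x : \sum_(j < k) \1_(B j) x <= 1 :> R.
Proof.
have [[j Bjx]|nB] := pselect (exists j, B j x).
  rewrite (bigD1 j)//= big1 => [|i ij]; first by rewrite addr0 indicE; case: (_ \in _).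
  rewrite indicE memNset// => Bix; move: ij.
  by rewrite (dB Bix Bjx) eqxx.
rewrite big1// => j _; rewrite indicE memNset// => Bjx.
by apply: nB; exists j.
Qed.

Variable h : n.-tuple T -> T -> R.
Hypothesis mh : measurable_fun [set: n.-tuple T * T] (fun p => h p.1 p.2).

Let loss a j X : \bar R :=
  (\int[mu]_x (\1_(B j) x * (Num.sqrt (h X x) - Num.sqrt (f a x)) ^+ 2)%:E)%E.

Let msqrt := @measurable_sqrtr R.

Let mf a : measurable_fun setT (f a). Proof. by case: (df a). Qed.

Let mhX X : measurable_fun setT (h X).
Proof. by apply: (measurableT_comp mh (pair1_measurable X)). Qed.

Let mdist X a :
  measurable_fun setT (fun x => (Num.sqrt (h X x) - Num.sqrt (f a x)) ^+ 2).
Proof.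
by apply: measurable_funX; apply: measurable_funB; exact: measurableT_comp.
Qed.

Let mlossX X a j : measurable_fun setT
  (fun x => (\1_(B j) x * (Num.sqrt (h X x) - Num.sqrt (f a x)) ^+ 2)%:E).
Proof.
apply/measurable_EFinP; apply: measurable_funM => //.
Qed.

Let term_ge0 (A : set T) x (r : R) : (0 <= (\1_A x * r ^+ 2)%:E)%E.
Proof. by rewrite lee_fin mulr_ge0// sqr_ge0. Qed.

Let loss_ge0 a j X : (0 <= loss a j X)%E.
Proof. by apply: integral_ge0 => x _. Qed.

Let mloss a j : measurable_fun setT (loss a j).
Proof.
apply: (measurable_fun_fubini_tonelli_F (m2 := mu) (fun p =>
  (\1_(B j) p.2 * (Num.sqrt (h p.1 p.2) - Num.sqrt (f a p.2)) ^+ 2)%:E)).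
  apply/measurable_EFinP; apply: measurable_funM.
    exact: (measurableT_comp (measurable_indic (D := setT) (mB j)) measurable_snd).
  apply: measurable_funX; apply: measurable_funB.
    exact: (measurableT_comp msqrt).
  apply: (measurableT_comp msqrt).
  exact: (measurableT_comp (mf a) measurable_snd).
by move=> p.
Qed.

Let sum_loss_le a X : (\sum_(j < k) loss a j X <=
  \int[mu]_x ((Num.sqrt (h X x) - Num.sqrt (f a x)) ^+ 2)%:E)%E.
Proof.
rewrite -ge0_integral_sum//.
apply: ge0_le_integral => //.
- by move=> x _; exact: sume_ge0.
- exact: emeasurable_sum.
- exact/measurable_EFinP.
move=> x _; rewrite sumEFin lee_fin -mulr_suml.
by rewrite ler_piMl ?sqr_ge0// sum_indic_le1.
Qed.

Variables rho delta : R.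
Hypotheses (rho0 : 0 <= rho) (rhon : 3 / 4 <= rho ^+ n)
  (delta0 : 0 <= delta)
  (affinity : forall a j,
    (rho%:E <= \int[mu]_x (Num.sqrt (f a x * f (flip a j) x))%:E)%E)
  (separation : forall a j, (delta%:E <=
    \int[mu]_x (\1_(B j) x *
                (Num.sqrt (f a x) - Num.sqrt (f (flip a j) x)) ^+ 2)%:E)%E).

(* Squared distance of square roots satisfies the triangle inequality up to a
   factor 2, so one value of [h] cannot be close to both densities on [B j]. *)
Let loss_flip a j X : ((delta / 2)%:E <= loss a j X + loss (flip a j) j X)%E.
Proof.
rewrite mulrC EFinM lee_pdivrMl//.
apply: (le_trans (separation a j)).
rewrite -ge0_integralD// -ge0_integralZl_EFin//; last 2 first.
- by move=> x _; exact: adde_ge0.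
- exact: emeasurable_funD.
apply: ge0_le_integral => //.
- apply/measurable_EFinP; apply: measurable_funM => //.
  by apply: measurable_funX; apply: measurable_funB; exact: measurableT_comp.
- by apply: measurable_funeM; exact: emeasurable_funD.
move=> x _; rewrite -EFinD -EFinM lee_fin -mulrDr [leRHS]mulrCA ler_wpM2l//.
have := sqr_ge0 (Num.sqrt (h X x) *+ 2 - Num.sqrt (f a x) - Num.sqrt (f (flip a j) x)).
by nra.
Qed.

Let risk a j : \bar R :=
  (\int[tuple_measure (density_probability (df a)) n]_X loss a j X)%E.

(* The two-point bound with weights 1 gives (delta / 2) (3 / 4 - 1 / 2). *)
Let risk_flip a j : ((delta / 8)%:E <= risk a j + risk (flip a j) j)%E.
Proof.
have d20 : 0 <= delta / 2 by rewrite divr_ge0.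
have := two_point_lower_bound (df a) (df (flip a j)) d20 rho0 (affinity a j)
  (mloss a j) (mloss (flip a j) j) (loss_ge0 a j) (loss_ge0 (flip a j) j)
  (loss_flip a j) ler01 ler01.
rewrite !mul1e mul1r sqrtr1 mul1r -leeBlDr// -EFinB; apply: le_trans.
by rewrite lee_fin; have := ler_wpM2l delta0 rhon; lra.
Qed.

(** Averaging over the cube replaces the supremum of the risk. The loss is at
    least the sum of its parts on the disjoint sets [B j], and for each [j] the
    vertices pair off along the edges of direction [j]; on each edge the two
    partial risks sum to at least [delta / 8], hence are [delta / 16] on
    average. *)
Lemma assouad S :
  (forall a, \int[tuple_measure (density_probability (df a)) n]_X
      \int[mu]_x ((Num.sqrt (h X x) - Num.sqrt (f a x)) ^+ 2)%:E <= S)%E ->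
  ((k%:R * (delta / 16))%:E <= S)%E.
Proof.
move=> leS; pose N := #|cube|.
have N0 : 0 < N%:R :> R.
  by rewrite ltr0n; apply/card_gt0P; exists [ffun=> true].
have sum_risk a : (\sum_(j < k) risk a j <= S)%E.
  apply: le_trans (leS a); rewrite -ge0_integral_sum//.
  apply: ge0_le_integral => //.
  - by move=> X _; exact: sume_ge0.
  - exact: emeasurable_sum.
  - apply: (measurable_fun_fubini_tonelli_F (m2 := mu) (fun p =>
      ((Num.sqrt (h p.1 p.2) - Num.sqrt (f a p.2)) ^+ 2)%:E)).
      apply/measurable_EFinP; apply: measurable_funX; apply: measurable_funB.
        exact: (measurableT_comp msqrt).
      apply: (measurableT_comp msqrt).
      exact: (measurableT_comp (mf a) measurable_snd).
    by move=> p; rewrite lee_fin sqr_ge0.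
case: S leS sum_risk => [s| |] leS sum_risk; last 2 first.
- by rewrite leey.
- have := sum_risk [ffun=> true]; rewrite leeNy_eq => /eqP rNy.
  have : (0 <= \sum_(j < k) risk [ffun=> true] j)%E.
    by apply: sume_ge0 => j _; exact: integral_ge0.
  by rewrite rNy.
have total : (\sum_(a : cube) \sum_(j < k) risk a j <= (N%:R * s)%:E)%E.
  apply: (@le_trans _ _ (\sum_(a : cube) s%:E)%E); first exact: lee_sum.
  by rewrite sumEFin sumr_const -/N mulr_natl.
have : (\sum_(j < k) \sum_(a : cube) (delta / 8)%:E <=
        (N%:R * s)%:E + (N%:R * s)%:E)%E.
  apply: le_trans (leeD total total).
  rewrite [X in (_ <= X + _)%E]exchange_big/= [X in (_ <= _ + X)%E]exchange_big/=.
  rewrite -big_split/=; apply: lee_sum => j _.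
  rewrite [X in (_ <= _ + X)%E](reindex_inj (inv_inj (flipK j)))/=.
  by rewrite -big_split/=; exact: lee_sum.
under eq_bigr do rewrite sumEFin sumr_const.
rewrite sumEFin sumr_const card_ord -EFinD lee_fin lee_fin -/N.
rewrite -[_ *+ N]mulr_natl -mulr_natl => H.
rewrite -(ler_pM2l N0); lra.
Qed.

End assouad.

(** * Square roots and unit-variance normal densities *)

Section sqrt_inequalities.
Context (R : realType).
Implicit Types r u v : R.

(** Cauchy-Schwarz for the vectors (sqrt r, sqrt u) and (sqrt r, sqrt v). *)
Lemma sqrt_mulD_ge r u v : 0 <= r -> 0 <= u -> 0 <= v ->
  r + Num.sqrt (u * v) <= Num.sqrt ((r + u) * (r + v)).
Proof.
move=> r0 u0 v0.
rewrite -(ler_pXn2r (n := 2))// ?nnegrE ?addr_ge0 ?sqrtr_ge0//.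
rewrite sqr_sqrtr ?mulr_ge0 ?addr_ge0// sqrrD sqr_sqrtr ?mulr_ge0//.
rewrite sqrtrM//.
have := sqr_sqrtr u0; have := sqr_sqrtr v0.
move=> v2 u2; have := sqr_ge0 (Num.sqrt u - Num.sqrt v).
rewrite sqrrB u2 v2 => uv.
suff : r * (Num.sqrt u * Num.sqrt v *+ 2) <= r * (u + v) by lra.
by rewrite ler_wpM2l//; lra.
Qed.

(** Adding a common term [r] brings the square roots closer, but only by a
    constant factor while [r] is at most [u] and [v]: in
    (u - v) / (sqrt (r + u) + sqrt (r + v)) the denominator grows by at most
    a factor sqrt 2. *)
Lemma sqr_sqrtB_addl_ge r u v : 0 <= r -> r <= u -> r <= v -> 0 < u ->
  (Num.sqrt u - Num.sqrt v) ^+ 2 / 2 <=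
  (Num.sqrt (r + u) - Num.sqrt (r + v)) ^+ 2.
Proof.
move=> r0 ru rv u0; have v0 : 0 <= v by exact: le_trans rv.
have xx := sqr_sqrtr (ltW u0); have yy := sqr_sqrtr v0.
have ss := sqr_sqrtr (addr_ge0 r0 (ltW u0)).
have tt := sqr_sqrtr (addr_ge0 r0 v0).
have x0 : 0 < Num.sqrt u by rewrite sqrtr_gt0.
have y0 := sqrtr_ge0 v.
have s0 := sqrtr_ge0 (r + u); have t0 := sqrtr_ge0 (r + v).
have st : Num.sqrt (r + u) * Num.sqrt (r + v) <= 2 * (Num.sqrt u * Num.sqrt v).
  rewrite -(ler_pXn2r (n := 2))// ?nnegrE ?mulr_ge0 ?(ltW x0)//.
  by rewrite !exprMn ss tt xx yy; nra.
move: x0 y0 s0 t0 xx yy ss tt st.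
set x := Num.sqrt u; set y := Num.sqrt v; set s := Num.sqrt (r + u).
set t := Num.sqrt (r + v) => x0 y0 s0 t0 xx yy ss tt st.
have xy0 : 0 < (x + y) ^+ 2 by rewrite exprn_gt0// ltr_wpDr.
rewrite -(ler_pM2r xy0).
have -> : (x - y) ^+ 2 / 2 * (x + y) ^+ 2 = (s - t) ^+ 2 * (s + t) ^+ 2 / 2.
  have : (x - y) * (x + y) = (s - t) * (s + t) by nra.
  by move=> /(congr1 (fun z => z ^+ 2 / 2)); rewrite !exprMn => ?; lra.
rewrite -mulrA ler_wpM2l ?sqr_ge0// !sqrrD; nra.
Qed.

End sqrt_inequalities.

Section unit_gaussian.
Context (R : realType).
Implicit Types c t : R.
Local Notation phi c := (normal_pdf c 1).

Lemma normal_pdf1E c t : phi c t = normal_peak 1 * expR (- (t - c) ^+ 2 / 2) :> R.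
Proof. by rewrite normal_pdfE ?oner_neq0// /normal_fun expr1n. Qed.

Lemma sqrt_normal_pdf1E c t :
  Num.sqrt (phi c t) = Num.sqrt (normal_peak 1) * expR (- (t - c) ^+ 2 / 4) :> R.
Proof.
rewrite normal_pdf1E sqrtrM ?normal_peak_ge0//; congr (_ * _).
rewrite (_ : expR _ = expR (- (t - c) ^+ 2 / 4) ^+ 2).
  by rewrite sqrtr_sqr ger0_norm// expR_ge0.
by rewrite -expRM_natl; congr expR; lra.
Qed.

Lemma sqrt_normal_pdf1M c c' t : Num.sqrt (phi c t * phi c' t) =
  expR (- (c - c') ^+ 2 / 8) * phi ((c + c') / 2) t :> R.
Proof.
rewrite sqrtrM ?normal_pdf_ge0// !sqrt_normal_pdf1E normal_pdf1E mulrACA -expr2.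
rewrite sqr_sqrtr ?normal_peak_ge0// [RHS]mulrCA -!expRD; congr (_ * expR _).
by field.
Qed.

Lemma normal_pdf1_ge_near c t : `|t - c| <= 2 -> normal_peak 1 * expR (- 2) <= phi c t :> R.
Proof.
move=> tc; rewrite normal_pdf1E ler_wpM2l ?normal_peak_ge0// ler_expR.
by move: tc; rewrite ler_norml => /andP[]; nra.
Qed.

Lemma normal_pdf1_le_far c t (A : R) : 0 <= A -> A <= `|t - c| ->
  phi c t <= normal_peak 1 * expR (- A ^+ 2 / 2) :> R.
Proof.
move=> A0 tc; rewrite normal_pdf1E ler_wpM2l ?normal_peak_ge0// ler_expR.
rewrite -[in X in X <= _](real_normK (num_real (t - c))).
have : A ^+ 2 <= `|t - c| ^+ 2 by rewrite ler_pXn2r// ?nnegrE//.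
by lra.
Qed.

(** To the left of the smaller mean the ratio of the two square roots is
    expR (s * eta / 2 - eta ^+ 2 / 4) with s = t - c, and
    s <= - 1 / 2 keeps its exponent below [- (eta / 4)]. Then
    1 - expR (- x) >= x / (1 + x) with x = eta / 4 <= 1 / 4 gives the
    constant 5. *)
Lemma sqr_sqrt_normal_pdf1B_ge c t (eta : R) : 0 <= eta <= 1 -> -1 <= t - c <= - 2^-1 ->
  normal_peak 1 * expR (- 2^-1) * eta ^+ 2 / 25 <=
  (Num.sqrt (phi c t) - Num.sqrt (phi (c + eta) t)) ^+ 2 :> R.
Proof.
move=> /andP[eta0 eta1] /andP[tc1 tc2]; rewrite !sqrt_normal_pdf1E -mulrBr exprMn.
rewrite sqr_sqrtr ?normal_peak_ge0// -!mulrA ler_wpM2l ?normal_peak_ge0//.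
set s := t - c in tc1 tc2 *.
have -> : - (t - (c + eta)) ^+ 2 / 4 = - s ^+ 2 / 4 + (s * eta / 2 - eta ^+ 2 / 4).
  by rewrite /s; field.
rewrite expRD -{1}[expR (- s ^+ 2 / 4)]mulr1 -mulrBr exprMn.
apply: ler_pM; rewrite ?expR_ge0 ?mulr_ge0 ?invr_ge0//.
  by rewrite -expRM_natl ler_expR; nra.
have low : eta / 5 <= 1 - expR (s * eta / 2 - eta ^+ 2 / 4).
  have h : expR (s * eta / 2 - eta ^+ 2 / 4) <= expR (- (eta / 4)).
    by rewrite ler_expR; nra.
  have := expR_ge1Dx (eta / 4); have := expRxMexpNx_1 (eta / 4).
  by have := expR_gt0 (- (eta / 4)); nra.
have eta5 : 0 <= eta / 5 by lra.
nra.
Qed.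

End unit_gaussian.

(** * The hypercube of normal mixtures on the line *)

Section mixtures_on_the_line.
Context (R : realType) (k : nat) (k0 : (0 < k)%N) (spacing eta : R).
Hypothesis eta01 : 0 <= eta <= 1.
Hypothesis spacingE : spacing = 2 * k%:R + 4.
Local Notation cube := {ffun 'I_k -> bool}.
Local Notation phi c := (normal_pdf c 1).
Local Notation mu := (@lebesgue_measure R).

(** The vertex [a] of the cube encodes, for each of [k] far apart positions,
    whether the atom there is moved to the right by [eta]. *)
Definition center (a : cube) (i : 'I_k) : R :=
  i%:R * spacing + (a i)%:R * eta.

Definition line_mixture (a : cube) (t : R) : R :=
  \sum_(i < k) k%:R^-1 * phi (center a i) t.

(** To the left of the two possible places of the atom [j], where moving the
    atom changes the density in one direction only. *)
Definition slab (j : 'I_k) : set R :=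
  `[j%:R * spacing - 1, j%:R * spacing - 2^-1]%classic.

Let kV0 : 0 < k%:R^-1 :> R. Proof. by rewrite invr_gt0 ltr0n. Qed.

Let term_ge0 a i t : 0 <= k%:R^-1 * phi (center a i) t.
Proof. by rewrite mulr_ge0 ?normal_pdf_ge0// ltW. Qed.

Let mterm a i : measurable_fun setT (fun t => k%:R^-1 * phi (center a i) t).
Proof. by apply: measurable_funM => //; exact: measurable_normal_pdf. Qed.

Lemma measurable_line_mixture a : measurable_fun setT (line_mixture a).
Proof. by apply: measurable_sum => i; exact: mterm. Qed.

Lemma line_mixture_ge0 a t : 0 <= line_mixture a t.
Proof. by apply: sumr_ge0 => i _. Qed.

Let integral_term a i : (\int[mu]_t (k%:R^-1 * phi (center a i) t)%:E = k%:R^-1%:E)%E.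
Proof.
under eq_integral do rewrite EFinM.
rewrite ge0_integralZl_EFin ?integral_normal_pdf ?mule1 ?(ltW kV0)//.
- by move=> t _; rewrite lee_fin normal_pdf_ge0.
- by apply/measurable_EFinP; exact: measurable_normal_pdf.
Qed.

Lemma integral_line_mixture a : (\int[mu]_t (line_mixture a t)%:E = 1)%E.
Proof.
under eq_integral do rewrite -sumEFin.
rewrite ge0_integral_sum//; last 2 first.
- by move=> i; apply/measurable_EFinP; exact: mterm.
- by move=> i t _; rewrite lee_fin.
under eq_bigr do rewrite integral_term.
rewrite sumEFin sumr_const card_ord -[_ *+ k]mulr_natr mulVf// pnatr_eq0 -lt0n//.
Qed.

Let rest a (j : 'I_k) t := \sum_(i < k | i != j) k%:R^-1 * phi (center a i) t.

Let rest_ge0 a j t : 0 <= rest a j t.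
Proof. by apply: sumr_ge0 => i _. Qed.

Let line_mixtureD1 a j t :
  line_mixture a t = rest a j t + k%:R^-1 * phi (center a j) t.
Proof. by rewrite /line_mixture (bigD1 j)//= addrC. Qed.

Let mrest a j : measurable_fun setT (rest a j).
Proof.
rewrite (_ : rest a j = fun t => line_mixture a t - k%:R^-1 * phi (center a j) t).
  by apply: measurable_funB; [exact: measurable_line_mixture|exact: mterm].
by apply/funext => t; rewrite (line_mixtureD1 a j) addrK.
Qed.

Let center_flip_neq a (i j : 'I_k) : i != j -> center (flip a j) i = center a i.
Proof. by move=> ij; rewrite /center ffunE (negbTE ij). Qed.

Let rest_flip a j t : rest (flip a j) j t = rest a j t.
Proof. by apply: eq_bigr => i ij; rewrite center_flip_neq. Qed.

Let center_flip a j :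
  (center a j = j%:R * spacing /\ center (flip a j) j = j%:R * spacing + eta) \/
  (center a j = j%:R * spacing + eta /\ center (flip a j) j = j%:R * spacing).
Proof.
rewrite /center ffunE eqxx; case: (a j); rewrite !(mul1r, mul0r) addr0.
  by right. by left.
Qed.

(** Flipping a coordinate moves one atom of weight 1 / k by [eta]. The other
    components are common to both densities and contribute their whole mass
    1 - 1 / k to the affinity, and the moved one contributes
    expR (- eta ^+ 2 / 8) / k. *)
Lemma line_mixture_affinity a j :
  ((1 - eta ^+ 2 / (8 * k%:R))%:E <=
   \int[mu]_t (Num.sqrt (line_mixture a t * line_mixture (flip a j) t))%:E)%E.
Proof.
pose c := center a j; pose c' := center (flip a j) j.
have cc : (c - c') ^+ 2 = eta ^+ 2.
  by rewrite /c /c'; case: (center_flip a j) => -[-> ->]; ring.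
pose e := expR (- (eta ^+ 2) / 8).
apply: (@le_trans _ _ (\int[mu]_t
    ((rest a j t)%:E + (k%:R^-1 * e)%:E * (phi ((c + c') / 2) t)%:E))%E); last first.
  apply: ge0_le_integral => //.
  - move=> t _; apply: adde_ge0; first by rewrite lee_fin.
    by rewrite -EFinM lee_fin !mulr_ge0 ?expR_ge0 ?normal_pdf_ge0 ?(ltW kV0).
  - apply: emeasurable_funD.
      by apply/measurable_EFinP; exact: mrest.
    apply: measurable_funeM; apply/measurable_EFinP; exact: measurable_normal_pdf.
  - apply/measurable_EFinP.
    apply: (measurableT_comp (@measurable_sqrtr R)).
    by apply: measurable_funM; exact: measurable_line_mixture.
  - move=> t _; rewrite -EFinM -EFinD lee_fin.
    rewrite (line_mixtureD1 a j) (line_mixtureD1 (flip a j) j) rest_flip.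
    apply: le_trans (sqrt_mulD_ge _ _ _) => //.
    rewrite lerD2l -/c -/c' mulrACA sqrtrM ?mulr_ge0 ?(ltW kV0)//.
    by rewrite -expr2 sqrtr_sqr gtr0_norm// sqrt_normal_pdf1M cc /e mulrA.
rewrite ge0_integralD//; last 4 first.
- by move=> t _; rewrite lee_fin.
- by apply/measurable_EFinP; exact: mrest.
- move=> t _; rewrite -EFinM lee_fin.
  by rewrite !mulr_ge0 ?expR_ge0 ?normal_pdf_ge0 ?(ltW kV0).
- by apply: measurable_funeM; apply/measurable_EFinP; exact: measurable_normal_pdf.
rewrite ge0_integralZl_EFin//; last 3 first.
- by move=> t _; rewrite lee_fin normal_pdf_ge0.
- by apply/measurable_EFinP; exact: measurable_normal_pdf.
- by rewrite mulr_ge0 ?expR_ge0 ?(ltW kV0).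
rewrite integral_normal_pdf mule1.
have -> : (\int[mu]_t (rest a j t)%:E = (1 - k%:R^-1)%:E)%E.
  have := integral_line_mixture a.
  under eq_integral do rewrite (line_mixtureD1 a j) EFinD.
  rewrite ge0_integralD//; last 4 first.
  - by move=> t _; rewrite lee_fin.
  - by apply/measurable_EFinP; exact: mrest.
  - by move=> t _; rewrite lee_fin.
  - by apply/measurable_EFinP; exact: mterm.
  rewrite integral_term EFinB => <-.
  by rewrite addeK.
rewrite -EFinD lee_fin.
have h : 1 + - (eta ^+ 2) / 8 <= e by exact: expR_ge1Dx.
have := ler_wpM2l (ltW kV0) h.
rewrite invfM; lra.
Qed.

Let slab_near a j t : slab j t -> `|t - center a j| <= 2.
Proof.
move: eta01 => /andP[eta0 eta1].
rewrite /slab /= in_itv/= => /andP[t1 t2]; rewrite /center ler_norml.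
by case: (a j); rewrite ?mul1r ?mul0r; apply/andP; split; lra.
Qed.

Let slab_far a i j t : i != j -> slab j t -> spacing - 2 <= `|t - center a i|.
Proof.
move: eta01 => /andP[eta0 eta1] ij.
rewrite /slab /= in_itv/= => /andP[t1 t2].
have aeta : 0 <= (a i)%:R * eta <= 1 by case: (a i); rewrite ?mul1r ?mul0r; lra.
have sp0 : 0 <= spacing by rewrite spacingE addr_ge0// mulr_ge0.
have [lij|lji|/val_inj eij] := ltngtP (i : nat) j; last by rewrite eij eqxx in ij.
- have : i.+1%:R <= j%:R :> R by rewrite ler_nat.
  rewrite -natr1 => ij1.
  have := ler_wpM2r sp0 ij1 => ij2.
  by rewrite /center; apply: le_trans (ler_norm _); lra.
- have : j.+1%:R <= i%:R :> R by rewrite ler_nat.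
  rewrite -natr1 => ij1.
  have := ler_wpM2r sp0 ij1 => ij2.
  by rewrite /center distrC; apply: le_trans (ler_norm _); lra.
Qed.

(* Each of the other components is at most 1 / k times the minimal value near
   its mean that the component [j] takes on the slab: with this spacing,
   (spacing - 2) ^+ 2 / 2 = 2 (k + 1) ^+ 2 >= k + 2, and expR k >= k. *)
Let rest_small a j t : slab j t ->
  rest a j t <= k%:R^-1 * (normal_peak 1 * expR (- 2)).
Proof.
move=> tj.
have far i : i != j -> phi (center a i) t <= k%:R^-1 * (normal_peak 1 * expR (- 2)).
  move=> ij; have s20 : 0 <= spacing - 2.
    by have := ler0n R k; rewrite spacingE; lra.
  apply: (le_trans (normal_pdf1_le_far s20 (slab_far a ij tj))).
  rewrite mulrCA ler_wpM2l ?normal_peak_ge0//.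
  have : expR (- (spacing - 2) ^+ 2 / 2) <= expR (- k%:R - 2).
    rewrite ler_expR spacingE.
    by have := ler0n R k; nra.
  move=> h; apply: (le_trans h).
  rewrite expRD ler_wpM2r ?expR_ge0// expRN lef_pV2 ?posrE ?expR_gt0 ?ltr0n//.
  by apply: le_trans (expR_ge1Dx _); rewrite lerDr.
apply: (@le_trans _ _ (\sum_(i < k) k%:R^-1 * (k%:R^-1 * (normal_peak 1 * expR (- 2))))).
  rewrite [leRHS](bigD1 j)//= -[leLHS]add0r.
  apply: lerD.
    by rewrite !mulr_ge0 ?expR_ge0 ?normal_peak_ge0 ?(ltW kV0).
  by apply: ler_sum => i ij; rewrite ler_wpM2l ?far// ltW.
rewrite sumr_const card_ord -[_ *+ k]mulr_natl.
by rewrite mulVKf// pnatr_eq0 -lt0n.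
Qed.

Let line_mixture_sqrtB_ge a j t : slab j t ->
  normal_peak 1 * expR (- 2^-1) * eta ^+ 2 / (50 * k%:R) <=
  (Num.sqrt (line_mixture a t) - Num.sqrt (line_mixture (flip a j) t)) ^+ 2.
Proof.
move=> tj.
rewrite (line_mixtureD1 a j) (line_mixtureD1 (flip a j) j) rest_flip.
have near b : rest a j t <= k%:R^-1 * phi (center b j) t.
  apply: (le_trans (rest_small a tj)).
  by rewrite ler_pM2l//; apply: normal_pdf1_ge_near; exact: slab_near.
apply: le_trans (sqr_sqrtB_addl_ge _ _ _ _) => //; last first.
  apply: mulr_gt0 => //; rewrite normal_pdf1E mulr_gt0 ?expR_gt0//.
  by rewrite normal_peak_gt0// oner_neq0.
rewrite !sqrtrM ?(ltW kV0)// -mulrBr exprMn sqr_sqrtr ?(ltW kV0)//.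
have tj' : -1 <= t - j%:R * spacing <= - 2^-1.
  by move: tj; rewrite /slab/= in_itv/= => /andP[? ?]; apply/andP; split; lra.
have := sqr_sqrt_normal_pdf1B_ge eta01 tj'.
set X := (_ - _) ^+ 2; have -> : (Num.sqrt (phi (center a j) t) -
    Num.sqrt (phi (center (flip a j) j) t)) ^+ 2 = X.
  by rewrite /X; case: (center_flip a j) => -[-> ->]//; rewrite -sqrrN opprB.
move=> h; rewrite invfM.
have := ler_wpM2l (ltW kV0) h; lra.
Qed.

Lemma slab_disjoint (i j : 'I_k) t : slab i t -> slab j t -> i = j.
Proof.
move=> ti tj; apply/eqP; apply: contraT => ij.
have := slab_far [ffun=> false] ij tj; have := slab_near [ffun=> false] ti.
have := ltr0n R k; rewrite k0 => ?.
by rewrite spacingE; lra.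
Qed.

(** On the slab [j] the component [j] dominates all the others together, so up
    to a factor 2 the distance is that of two normal densities with means
    [eta] apart, weighted by 1 / k; the slab has length 1 / 2. *)
Lemma line_mixture_separation a j :
  ((normal_peak 1 * expR (- 2^-1) * eta ^+ 2 / (100 * k%:R))%:E <=
   \int[mu]_t (\1_(slab j) t *
     (Num.sqrt (line_mixture a t) - Num.sqrt (line_mixture (flip a j) t)) ^+ 2)%:E)%E.
Proof.
pose c := normal_peak 1 * expR (- 2^-1) * eta ^+ 2 / (50 * k%:R).
have c0 : 0 <= c.
  apply: divr_ge0; last by rewrite mulr_ge0.
  by apply: mulr_ge0 (sqr_ge0 _); rewrite mulr_ge0 ?normal_peak_ge0 ?expR_ge0.
have mslab : measurable (slab j) by exact: measurable_itv.
have sqrtm a' : measurable_fun setT (fun t => Num.sqrt (line_mixture a' t)).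
  apply: (measurableT_comp (@measurable_sqrtr R)); exact: measurable_line_mixture.
apply: (@le_trans _ _ (\int[mu]_t (c%:E * (\1_(slab j) t)%:E))%E).
  rewrite ge0_integralZl_EFin//; last exact/measurable_EFinP.
  rewrite integral_indic// setIT.
  have := lebesgue_measure_itv `[j%:R * spacing - 1, j%:R * spacing - 2^-1].
  rewrite /= lte_fin ifT => [->|]; last by lra.
  rewrite -EFinB -EFinM lee_fin /c !invfM; lra.
apply: ge0_le_integral => //.
- by move=> t _; rewrite -EFinM lee_fin mulr_ge0.
- by apply: measurable_funeM; apply/measurable_EFinP.
- apply/measurable_EFinP; apply: measurable_funM => //.
  by apply: measurable_funX; apply: measurable_funB; exact: sqrtm.
move=> t _; rewrite -EFinM lee_fin mulrC indicE.
have [|_] := boolP (t \in slab j); last by rewrite !mul0r.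
by rewrite inE => tj; rewrite !mul1r; exact: line_mixture_sqrtB_ge.
Qed.

End mixtures_on_the_line.

(** * The standard normal density in d dimensions *)

Section standard_normal_tuple.
Context (R : realType).
Local Notation phi c := (normal_pdf c 1).

Definition tail d (x : d.+1.-tuple (measurableTypeR R)) :
  d.-tuple (measurableTypeR R) := [tuple of behead x].

Lemma measurable_tail d : measurable_fun setT (@tail d).
Proof. exact: measurable_behead. Qed.

Definition on_axis d (c : R) : d.+1.-tuple (measurableTypeR R) :=
  tuple_cons (c, [tuple (0 : R) | _ < d]).

Lemma std_normal_densityE d (z : d.-tuple (measurableTypeR R)) :
  std_normal_density z =
  (2 * pi) `^ (- (d%:R / 2)) * expR (- ((\sum_(i < d) tnth z i ^+ 2) / 2)).
Proof.
by rewrite /std_normal_density /euclidean_norm sqr_sqrtr// sumr_ge0// => i _;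
  exact: sqr_ge0.
Qed.

Lemma std_normal_density_ge0 d (z : d.-tuple (measurableTypeR R)) :
  0 <= std_normal_density z.
Proof. by rewrite mulr_ge0 ?powR_ge0 ?expR_ge0. Qed.

Lemma measurable_std_normal_density d :
  measurable_fun setT (@std_normal_density R d).
Proof.
rewrite (_ : @std_normal_density R d = fun z => (2 * pi) `^ (- (d%:R / 2)) *
    expR (- ((\sum_(i < d) tnth z i ^+ 2) / 2))); last first.
  by apply/funext => z; exact: std_normal_densityE.
apply: measurable_funM => //; apply: measurableT_comp => //.
apply: measurableT_comp => //; apply: measurable_funM => //.
by apply: measurable_sum => i; apply: measurable_funX; exact: measurable_tnth.
Qed.

(** With means on the first axis only the first coordinate sees the mean, which
    is how every integral below reduces to the line. *)
Lemma std_normal_density_on_axis d c (x : d.+1.-tuple (measurableTypeR R)) :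
  std_normal_density (tuple_sub x (on_axis d c)) =
  phi c (thead x) * std_normal_density (tail x).
Proof.
rewrite !std_normal_densityE normal_pdf1E mulrACA -expRD.
congr (_ * expR _).
  have p0 : 0 < 2 * pi :> R by rewrite mulr_gt0// pi_gt0.
  rewrite -[d.+1%:R]natr1 [(d%:R + 1) / 2]mulrDl opprD powRD; last by rewrite (gt_eqF p0) implybT.
  rewrite mulrC; congr (_ * _); rewrite div1r powRN powR12_sqrt ?(ltW p0)//.
  by rewrite /normal_peak expr1n mul1r mulr_natl.
rewrite big_ord_recl mulrDl opprD; congr (_ + _).
  rewrite tnth_mktuple mulNr; congr (- (_ ^+ 2 / _)).
congr (- (_ / 2)); apply: eq_bigr => i _.
rewrite tnth_mktuple /tail /on_axis tnthS tnth_mktuple subr0.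
by congr (_ ^+ 2); rewrite [in LHS](tuple_eta x) tnthS.
Qed.

(** The total mass of the normal density in dimension [d] is a hypothesis here
    because this lemma is the induction step that proves it. *)
Lemma integral_head_tail d (F : R -> R) :
  measurable_fun setT F -> (forall t, 0 <= F t) ->
  (\int[@lebesgue_measure_tuple R d]_x (std_normal_density x)%:E = 1)%E ->
  (\int[@lebesgue_measure_tuple R d.+1]_x
     (F (thead x) * std_normal_density (tail x))%:E =
   \int[@lebesgue_measure R]_t (F t)%:E)%E.
Proof.
move=> mF F0 psi1.
have mp := @measurable_std_normal_density d.
rewrite [LHS](@integral_tuple_measureS _ _ R lebesgue_measure d); last 2 first.
- apply/measurable_EFinP; apply: measurable_funM.
    exact: (measurableT_comp mF (measurable_tnth ord0)).
  exact: (measurableT_comp mp (@measurable_tail d)).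
- by move=> x; rewrite lee_fin mulr_ge0 ?std_normal_density_ge0.
apply: eq_integral => t _.
have pos (x : d.-tuple (measurableTypeR R)) :
    setT x -> (0 <= (std_normal_density x)%:E)%E.
  by move=> _; rewrite lee_fin std_normal_density_ge0.
have mEp : measurable_fun setT (fun x => (@std_normal_density R d x)%:E).
  exact/measurable_EFinP.
rewrite -[RHS]mule1 -psi1.
rewrite -(ge0_integralZl_EFin (@lebesgue_measure_tuple R d) measurableT pos mEp (F0 t)).
apply: eq_integral => x _; rewrite -EFinM; congr (_ * std_normal_density _)%:E.
exact: val_inj.
Qed.

Lemma integral_std_normal_density d :
  (\int[@lebesgue_measure_tuple R d]_x (std_normal_density x)%:E = 1)%E.
Proof.
elim: d => [|d IH].
  rewrite /lebesgue_measure_tuple /= integral_dirac//; last first.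
    by apply/measurable_EFinP; exact: measurable_std_normal_density.
  by rewrite diracT mul1e std_normal_densityE big_ord0 !mul0r !oppr0 powRr0 expR0 mulr1.
rewrite -(integral_normal_pdf (0 : R) 1).
rewrite -(integral_head_tail (measurable_normal_pdf 0 1) (normal_pdf_ge0 0 1) IH).
apply: eq_integral => x _; rewrite -std_normal_density_on_axis.
congr (std_normal_density _)%:E; apply/eq_from_tnth => i.
rewrite tnth_mktuple /on_axis.
by case: (unliftP ord0 i) => [j|] ->; rewrite ?tnthS ?tnth_mktuple subr0.
Qed.

End standard_normal_tuple.

(** * Uniform mixing laws *)

Section uniform_on_points.
Context d (T : measurableType d) (R : realType) (k : nat) (pts : 'I_k.+1 -> T).

(** A point listed several times counts with its multiplicity. *)
Definition uniform_on_points : set T -> \bar R :=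
  msum (fun i => mscale (k.+1%:R^-1)%:nng \d_(pts (inord i))) k.+1.

HB.instance Definition _ := Measure.on uniform_on_points.

Lemma uniform_on_pointsE A :
  (uniform_on_points A = \sum_(i < k.+1) (k.+1%:R^-1 * \1_A (pts i))%:E)%E.
Proof.
rewrite /uniform_on_points /msum/=; apply: eq_bigr => i _.
by rewrite /mscale/= inord_val EFinM.
Qed.

Lemma uniform_on_points_all A :
  (forall i, A (pts i)) -> uniform_on_points A = 1%E.
Proof.
move=> Apts; rewrite uniform_on_pointsE.
under eq_bigr => i _ do rewrite indicE mem_set// mulr1.
by rewrite sumEFin sumr_const card_ord -[_ *+ _]mulr_natl mulfV.
Qed.

HB.instance Definition _ := Measure_isProbability.Build _ _ _ uniform_on_points
  (@uniform_on_points_all setT (fun=> I)).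

Lemma integral_uniform_on_points (g : T -> R) :
  measurable_fun setT g -> (forall x, 0 <= g x) ->
  \int[uniform_on_points]_x g x = \sum_(i < k.+1) k.+1%:R^-1 * g (pts i).
Proof.
move=> mg g0; rewrite /Rintegral.
have mEg : measurable_fun setT (EFin \o g) by exact/measurable_EFinP.
rewrite ge0_integral_measure_sum//; last by move=> x _; rewrite lee_fin.
under eq_bigr => i _.
  rewrite ge0_integral_mscale//=; last by move=> x _; rewrite lee_fin.
  rewrite integral_dirac// diracT mul1e inord_val -EFinM.
  over.
by rewrite sumEFin.
Qed.

Lemma uniform_on_points_gt0 i :
  (0 < uniform_on_points [set pts i])%E.
Proof.
rewrite uniform_on_pointsE sumEFin lte_fin (bigD1 i)//= ltr_pwDl//.
  by rewrite indicE mem_set// mulr1.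
by apply: sumr_ge0 => j _; rewrite mulr_ge0.
Qed.

Lemma uniform_on_points_eq0 x : (forall i, pts i <> x) ->
  uniform_on_points [set x] = 0%E.
Proof.
move=> nx; rewrite uniform_on_pointsE big1// => i _.
by rewrite indicE memNset ?mulr0//; exact: nx.
Qed.

End uniform_on_points.

Lemma gaussian_mixtures_uniform (R : realType) d k
    (pts : 'I_k.+1 -> d.-tuple (measurableTypeR R)) :
  gaussian_mixtures R d k.+1 (fun x =>
    \sum_(i < k.+1) k.+1%:R^-1 * std_normal_density (tuple_sub x (pts i))).
Proof.
exists (uniform_on_points R pts); split.
- by apply: uniform_on_points_all => i; exact: uniform_on_points_gt0.
- apply: (@card_le_trans _ _ _ [set pts (inord i) | i in `I_k.+1]).
    apply: subset_card_le => x /=; rewrite /atoms/= => x0.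
    have [[i ix]|nx] := pselect (exists i, pts i = x).
      by exists i => //; rewrite inord_val.
    move: x0; rewrite uniform_on_points_eq0 ?ltxx// => i ix.
    by apply: nx; exists i.
  exact: card_image_le.
apply/funext => x; rewrite /gaussian_mixture integral_uniform_on_points//.
  apply: (measurableT_comp (@measurable_std_normal_density R d)).
  apply/measurable_fun_tnthP => i.
  rewrite (_ : _ \o _ = fun t => tnth x i - tnth t i).
    by apply: measurable_funB => //; exact: measurable_tnth.
  by apply/funext => t /=; rewrite tnth_mktuple.
by move=> t; exact: std_normal_density_ge0.
Qed.

(** * The hypercube in d dimensions and the minimax bound *)

Lemma bernoulli_ineq (R : realType) (x : R) n : 0 <= x <= 1 ->
  1 - n%:R * x <= (1 - x) ^+ n.
Proof.
move=> /andP[x0 x1]; elim: n => [|n IH]; first by rewrite mul0r subr0 expr0.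
rewrite exprS; apply: (@le_trans _ _ ((1 - x) * (1 - n%:R * x))).
  rewrite -natr1; have := mulr_ge0 (ler0n R n) (sqr_ge0 x).
  by rewrite expr2; nra.
by rewrite ler_wpM2l// subr_ge0.
Qed.

Section hypercube.
Context (R : realType) (d k n : nat) (kn : (k.+1 <= n)%N).
Local Notation E := (d.+1.-tuple (measurableTypeR R)).
Local Notation cube := {ffun 'I_k.+1 -> bool}.
Local Notation mu := (@lebesgue_measure_tuple R d.+1).

Let spacing : R := 2 * k.+1%:R + 4.
(* Then the affinity of neighbours is at least 1 - eta ^+ 2 / (8 k) =
   1 - 1 / (8 n), so that n observations hardly tell neighbours apart, and
   k <= n makes the displacement at most 1. *)
Let eta : R := Num.sqrt (k.+1%:R / n%:R).

Let n0 : 0 < n%:R :> R. Proof. by rewrite ltr0n (leq_trans _ kn). Qed.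
Let eta2 : eta ^+ 2 = k.+1%:R / n%:R.
Proof. by rewrite sqr_sqrtr// divr_ge0. Qed.

Let eta01 : 0 <= eta <= 1.
Proof.
rewrite sqrtr_ge0/= -(ler_pXn2r (n := 2)) ?nnegrE ?sqrtr_ge0//.
by rewrite eta2 expr1n ler_pdivrMr// mul1r ler_nat.
Qed.

Let g (a : cube) : R -> R := line_mixture spacing eta a.

Definition cube_mixture (a : cube) (x : E) : R :=
  g a (thead x) * std_normal_density (tail x).

Lemma cube_mixture_gaussian a : gaussian_mixtures R d.+1 k.+1 (cube_mixture a).
Proof.
have := gaussian_mixtures_uniform (fun i => on_axis d (center spacing eta a i)).
congr (gaussian_mixtures _ _ _ _); apply/funext => x.
rewrite /cube_mixture /g /line_mixture mulr_suml; apply: eq_bigr => i _.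
by rewrite std_normal_density_on_axis mulrA.
Qed.

Let mg a : measurable_fun setT (g a). Proof. exact: measurable_line_mixture. Qed.
Let g0 a t : 0 <= g a t. Proof. exact: line_mixture_ge0. Qed.
Let psi1 := @integral_std_normal_density R d.

Lemma cube_mixture_density a : probability_density mu (cube_mixture a).
Proof.
split.
- apply: measurable_funM.
    exact: (measurableT_comp (mg a) (measurable_tnth ord0)).
  exact: (measurableT_comp (@measurable_std_normal_density R d)
    (@measurable_tail R d)).
- by move=> x; rewrite mulr_ge0 ?std_normal_density_ge0.
- by rewrite [LHS](integral_head_tail (mg a) (g0 a) psi1) integral_line_mixture.
Qed.

Let msqrt := @measurable_sqrtr R.

Lemma cube_mixture_affinity a j : ((1 - 1 / (8 * n%:R))%:E <=
  \int[mu]_x (Num.sqrt (cube_mixture a x * cube_mixture (flip a j) x))%:E)%E.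
Proof.
have := @line_mixture_affinity R k.+1 isT spacing eta a j.
rewrite -/(g _) -(@integral_head_tail R d (fun t => Num.sqrt (g a t * g (flip a j) t)))//.
  rewrite eta2 (_ : _ / (8 * _) = 1 / (8 * n%:R)); last first.
    by field; rewrite (gt_eqF n0) /= ?pnatr_eq0.
  move=> /le_trans; apply; rewrite le_eqVlt; apply/orP; left; apply/eqP.
  apply: eq_integral => x _; congr EFin.
  rewrite /cube_mixture [in RHS]mulrACA [in RHS]sqrtrM ?mulr_ge0//.
  by rewrite -expr2 sqrtr_sqr ger0_norm ?std_normal_density_ge0.
by apply: (measurableT_comp msqrt); exact: measurable_funM.
Qed.

Definition cube_slab (j : 'I_k.+1) : set E := (@thead _ _) @^-1` slab spacing j.

Lemma measurable_cube_slab j : measurable (cube_slab j).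
Proof.
rewrite -[cube_slab j]setTI; apply: (measurable_tnth ord0) => //.
exact: measurable_itv.
Qed.

Lemma cube_mixture_separation a j :
  ((normal_peak 1 * expR (- 2^-1) / 100 / n%:R)%:E <=
   \int[mu]_x (\1_(cube_slab j) x * (Num.sqrt (cube_mixture a x) -
                  Num.sqrt (cube_mixture (flip a j) x)) ^+ 2)%:E)%E.
Proof.
have := @line_mixture_separation R k.+1 isT spacing eta eta01 erefl a j.
rewrite -/(g _) -(@integral_head_tail R d (fun t => \1_(slab spacing j) t *
   (Num.sqrt (g a t) - Num.sqrt (g (flip a j) t)) ^+ 2))//.
- rewrite eta2 (_ : _ / (100 * _) = normal_peak 1 * expR (- 2^-1) / 100 / n%:R);
    last by field; rewrite (gt_eqF n0) /= ?pnatr_eq0.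
  move=> /le_trans; apply; rewrite le_eqVlt; apply/orP; left; apply/eqP.
  apply: eq_integral => x _; congr EFin.
  rewrite /cube_mixture (sqrtrM _ (g0 a _)) (sqrtrM _ (g0 (flip a j) _)) -mulrBl exprMn.
  rewrite sqr_sqrtr ?std_normal_density_ge0// [RHS]mulrA; congr (_ * _ * _).
- apply: measurable_funM; first by apply: measurable_indic; exact: measurable_itv.
  apply: measurable_funX; apply: measurable_funB;
    exact: (measurableT_comp msqrt).
- by move=> t; rewrite mulr_ge0 ?sqr_ge0.
Qed.

(** Assouad's lemma with separation of order 1 / n on each of the [k.+1] slabs;
    Bernoulli's inequality bounds the affinity of the samples from below by
    7 / 8. *)
Lemma cube_risk_lower_bound (h : n.-tuple E -> E -> R) (S : \bar R) :
  estimators h -> 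
  (forall a, hellinger_risk h (cube_mixture a) <= S)%E ->
  ((normal_peak 1 * expR (- 2^-1) / 1600 * (k.+1%:R / n%:R))%:E <= S)%E.
Proof.
move=> [mh h0] leS.
pose rho : R := 1 - 1 / (8 * n%:R).
have n1 : 1 <= n%:R :> R by rewrite ler1n (leq_trans _ kn).
have x01 : 0 <= (1 / (8 * n%:R) : R) <= 1.
  rewrite divr_ge0 ?mulr_ge0//= ler_pdivrMr ?mulr_gt0//; lra.
have rho0 : 0 <= rho by rewrite subr_ge0; case/andP: x01.
have rhon : 3 / 4 <= rho ^+ n.
  apply: le_trans (bernoulli_ineq n x01).
  have -> : n%:R * (1 / (8 * n%:R)) = 1 / 8 :> R.
    by field; rewrite (gt_eqF n0).
  lra.
have delta0 : 0 <= normal_peak 1 * expR (- 2^-1) / 100 / n%:R :> R.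
  by rewrite !divr_ge0// mulr_ge0 ?normal_peak_ge0 ?expR_ge0.
have dB i j x : cube_slab i x -> cube_slab j x -> i = j.
  exact: (@slab_disjoint R k.+1 isT spacing eta eta01).
have := @assouad _ _ R mu k.+1 n cube_mixture cube_slab cube_mixture_density
  measurable_cube_slab dB h mh rho _ rho0 rhon delta0 cube_mixture_affinity
  cube_mixture_separation S leS.
apply: le_trans; rewrite lee_fin le_eqVlt; apply/orP; left; apply/eqP.
by field; rewrite (gt_eqF n0).
Qed.

End hypercube.

Theorem lemma2p4 (R : realType) :
  exists C : R, 0 < C /\
    forall d n k : nat, (1 <= d)%N -> (2 <= n)%N -> (1 <= k <= n)%N ->
      ((C * (k%:R / n%:R))%:E <= minimax_risk n (gaussian_mixtures R d k))%E.
Proof.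
exists (normal_peak 1 * expR (- 2^-1) / 1600); split.
  apply: divr_gt0; last by rewrite ltr0n.
  by apply: mulr_gt0 (expR_gt0 _); rewrite normal_peak_gt0 ?oner_neq0.
move=> [//|d] n [|k] _ _ /andP[] // _ kn.
apply: le_ereal_inf_tmp => _ [h eh <-].
apply: (cube_risk_lower_bound kn eh) => a.
by apply: ereal_sup_ubound; exists (cube_mixture n a) => //; exact: cube_mixture_gaussian.
Qed.
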